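(* Let $X=(X_t)_{t\ge0}$ be an $\mathbf{F}$-adapted càdlàg real-valued process on $(\Omega,\mathcal{F},\mathbf{F},\mathbb{P})$ and let $f:\mathbb{R}^+\times\mathbb{R}\to\mathbb{R}$ be (Borel) measurable. Let $A\subseteq\mathbb{R}$ be a Borel set with $0\notin\overline{A}$ and let $t>0$. Let $(T_n)_{n\in\mathbb{N}}$ be a sequence of $\mathbf{F}$-stopping times with pairwise disjoint graphs such that $\{\Delta X\ne0\}=\bigcup_{n=1}^\infty[\![T_n]\!]$. Then for almost every $\omega\in\Omega$ the function $\mathbf{1}_{[0,t]\times A}\,f$ is integrable with respect to the jump measure $j_X(\omega,d(s,x))$, and $$\int_{[0,t]\times A}f(s,x)\,j_X(\omega,d(s,x))=\sum_{0<s\le t}f\big(s,\Delta X_s(\omega)\big)\mathbf{1}_A(\Delta X_s(\omega))=\sum_{n=1}^\infty f\big(T_n(\omega),\Delta X_{T_n(\omega)}(\omega)\big)\,\mathbf{1}_A\big(\Delta X_{T_n(\omega)}(\omega)\big)\,\mathbf{1}_{\{T_n\le t\}}(\omega).$$ Moreover, given $\omega\in\Omega$ there exists $c_t^A(\omega)\in\mathbb{R}^+$ such that $$\int_{[0,t]\times A}|f(s,x)|\,j_X(\omega,d(s,x))\le c_t^A(\omega)\,j_X(\omega,[0,t]\times A).$$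
   Context: $(\Omega,\mathcal{F},\mathbf{F},\mathbb{P})$ is a filtered probability space whose filtration $\mathbf{F}=(\mathcal{F}_t)_{t\ge0}$ satisfies the usual conditions. $\mathbb{R}^+=[0,\infty)$. The jump process is $\Delta X_t:=X_{t+}-X_{t-}$ with the convention $X_{0-}:=X_{0+}$, and $\{\Delta X\ne0\}:=\{(\omega,t)\in\Omega\times\mathbb{R}^+:\Delta X_t(\omega)\ne0\}$. Stopping times take values in $[0,\infty]$, and the graph of $T$ is $[\![T]\!]:=\{(\omega,t)\in\Omega\times\mathbb{R}^+:T(\omega)=t\}$. By a theorem of Dellacherie a sequence $(T_n)$ as in the claim always exists. Terms of the series with $T_n(\omega)=+\infty$ are $0$. The jump measure of $X$ is, for $\omega\in\Omega$ and Borel $B\subseteq\mathbb{R}^+\times\mathbb{R}$, $$j_X(\omega,B):=\sum_{s>0}\mathbf{1}_B\big(s,\Delta X_s(\omega)\big)\mathbf{1}_{\mathbb{R}\setminus\{0\}}(\Delta X_s(\omega))=\#\{s>0:\Delta X_s(\omega)\ne0\text{ and }(s,\Delta X_s(\omega))\in B\}.$$ *)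

(* Defs.v *)
From HB Require Import structures.
From mathcomp Require Import all_boot all_order all_algebra.
From mathcomp Require Import all_classical all_reals all_analysis.

Set Implicit Arguments.
Unset Strict Implicit.
Unset Printing Implicit Defensive.
Import Order.TTheory GRing.Theory Num.Theory.
Import numFieldNormedType.Exports.

Local Open Scope classical_set_scope.
Local Open Scope ring_scope.

(* The time set [0, +oo) is embedded in R: processes, filtrations and functions
   of time are total on R, and only their values at nonnegative times matter. *)

Section filtrations.
Context {R : realType} {d : measure_display} {Omega : measurableType d}.

Definition filtration (F : R -> set (set Omega)) : Prop :=
  [/\ forall t, 0 <= t -> sigma_algebra setT (F t),
      forall t, 0 <= t -> F t `<=` measurable
    & forall s t, 0 <= s -> s <= t -> F s `<=` F t].

(* The first condition entails that the probability space is complete. *)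
Definition usual_conditions (P : probability Omega R)
    (F : R -> set (set Omega)) : Prop :=
  P.-negligible `<=` F 0 /\
  forall t, 0 <= t -> F t = \bigcap_(s in [set s | t < s]) F s.

Definition adapted (F : R -> set (set Omega)) (X : R -> Omega -> R) : Prop :=
  forall t, 0 <= t -> forall B : set R, measurable B -> F t (X t @^-1` B).

Definition stopping_time (F : R -> set (set Omega)) (T : Omega -> \bar R) :
    Prop :=
  (forall w, (0 <= T w)%E) /\
  forall t, 0 <= t -> F t [set w | (T w <= t%:E)%E].

Definition graph (T : Omega -> \bar R) : set (Omega * R) :=
  [set p | 0 <= p.2 /\ T p.1 = p.2%:E].

End filtrations.

Section jumps.
Context {R : realType} {Omega : Type}.
Implicit Type X : R -> Omega -> R.

(* Every path is cadlag, with finite left limits. *)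
Definition cadlag X : Prop :=
  forall w,
    (forall t, 0 <= t -> X s w @[s --> t^'+] --> X t w) /\
    (forall t, 0 < t -> cvg (X s w @[s --> t^'-])).

Definition right_limit X (t : R) (w : Omega) : R :=
  lim (X s w @[s --> t^'+]).

Definition left_limit X (t : R) (w : Omega) : R :=
  if t == 0 then right_limit X 0 w else lim (X s w @[s --> t^'-]).

Definition jump X (t : R) (w : Omega) : R := right_limit X t w - left_limit X t w.

Definition jump_set X : set (Omega * R) :=
  [set p | 0 <= p.2 /\ jump X p.2 p.1 != 0].

(* As a measure on R * R it is concentrated on (0, +oo) * (R \ {0}). *)
Definition jump_measure X (w : Omega) (B : set (R * R)) : \bar R :=
  (\esum_(s in [set s : R | (0 < s)%R])
     (\1_B (s, jump X s w) * \1_(~` [set 0%R]) (jump X s w))%R%:E)%E.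

End jumps.

Section jump_measure_measure.
Context {R : realType} {Omega : Type} (X : R -> Omega -> R) (w : Omega).
Local Open Scope ereal_scope.

Let term_ge0 (B : set (R * R)) s :
  0 <= (\1_B (s, jump X s w) * \1_(~` [set 0%R]) (jump X s w) : R)%R%:E.
Proof. by rewrite lee_fin mulr_ge0. Qed.

Let jump_measure0 : jump_measure X w set0 = 0.
Proof. by rewrite /jump_measure esum1// => s _; rewrite indic0 mul0r. Qed.

Let jump_measure_ge0 B : 0 <= jump_measure X w B.
Proof. by apply: esum_ge0 => s _; exact: term_ge0. Qed.

Let jump_measure_semi_sigma_additive :
  semi_sigma_additive (jump_measure X w : set (R * R) -> \bar R).
Proof.
move=> B mB tB _.
pose c s : R := \1_(~` [set 0%R]) (jump X s w).
pose a n s : \bar R := ((\1_(B n) (s, jump X s w) : R) * c s)%R%:E.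
have a0 n s : 0 <= a n s by exact: term_ge0.
have -> : jump_measure X w (\bigcup_n B n) =
    \sum_(0 <= n <oo) jump_measure X w (B n).
  rewrite nneseries_esumT; last by move=> n; exact: jump_measure_ge0.
  rewrite [RHS](_ : _ = \esum_(n in setT) \esum_(s in [set s : R | (0 < s)%R]) a n s)//.
  rewrite esum_esum//.
  rewrite (reindex_esum ([set s : R | (0 < s)%R] `*`` (fun=> [set: nat])) _
    (fun p => (p.2, p.1))); last first.
    split=> [[s n] [/= ? _]//|[s n] [s' n'] _ _ [-> ->]//|[n s] [/= _ ?]].
    by exists (s, n).
  rewrite -(@esum_esum _ _ _ _ (fun=> setT) (fun s n => a n s))//.
  apply: eq_esum => s _; rewrite -nneseries_esumT//.
  rewrite EFinM.
  have -> : ((\1_(\bigcup_n B n) (s, jump X s w) : R)%:E) =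
      \d_((s, jump X s w) : R * R) (\bigcup_n B n) by [].
  rewrite measure_semi_bigcup//; last exact: bigcup_measurable.
  rewrite muleC -nneseriesZl//.
  by apply: eq_eseriesr => n _; rewrite muleC.
by apply: is_cvg_nneseries => n _ _; exact: jump_measure_ge0.
Qed.

HB.instance Definition _ := isMeasure.Build _ (R * R)%type R (jump_measure X w)
  jump_measure0 jump_measure_ge0 jump_measure_semi_sigma_additive.

End jump_measure_measure.

Section sums.
Context {R : realType}.

(* The sum of a summable family of reals indexed by a possibly uncountable set;
   it is only meaningful when the family is summable. *)
Definition family_sum (D : set R) (g : R -> R) : \bar R :=
  (\esum_(s in D) (EFin \o g)^\+ s - \esum_(s in D) (EFin \o g)^\- s)%E.

(* The value of g at a random time, read as 0 when the time is infinite. *)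
Definition eval_at_time (g : R -> R) (tau : \bar R) : R :=
  if tau is s%:E then g s else 0.

End sums.

(* Main.v *)
Require Import Defs.
From HB Require Import structures.
From mathcomp Require Import all_boot all_order all_algebra.
From mathcomp Require Import finmap.
From mathcomp Require Import all_classical all_reals all_analysis.
From mathcomp Require Import measurable_realfun lra.

Set Implicit Arguments.
Unset Strict Implicit.
Unset Printing Implicit Defensive.
Import Order.TTheory GRing.Theory Num.Theory.
Import numFieldNormedType.Exports.

Local Open Scope classical_set_scope.
Local Open Scope ring_scope.

(** The argument is pathwise, and its conclusions hold for every outcome w.

    Since 0 is not in the closure of A, all points of A have absolute value at
    least some e > 0.  A cadlag path has only finitely many jumps of size at
    least e on a bounded interval: around each time u, the one-sided limits
    confine the path, on each side of u, to a band narrower than e, so that no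
    jump of size e occurs there except possibly at u itself, and the compactness
    of [0, t] concludes ([finite_large_jumps]).  Hence the set [jump_times] of
    the times in (0, t] at which the jump lies in A is finite.

    Inside [0, t] x A the jump measure is therefore the finite sum of the Dirac
    masses at the points (s, jump at s), s in [jump_times] ([jump_measureE]), and
    the integral of any measurable real function over [0, t] x A is the finite
    sum of its values at these points ([integral_jump_measure]).  Integrability,
    summability of the family and the first formula for the integral follow.  In
    the last inequality one can take for c the integral of |f| itself: it is a
    finite sum whose terms are all at most c, and the jump measure counts them.

    Finally, the graphs of the [T n] cover the jumps and are disjoint, so
    [n |-> T n w] is a bijection from a finite set of indices onto [jump_times];
    the other terms of the series vanish, and its partial sums are eventually
    constant ([jump_series_cvg]). *)

(** * Finiteness of the large jumps of a cadlag path *)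

Lemma finite_of_locally_finite (T : ptopologicalType) (K S : set T) :
  compact K -> S `<=` K ->
  (forall u, K u -> exists U, [/\ open U, U u & finite_set (S `&` U)]) ->
  finite_set S.
Proof.
rewrite compact_cover => cK SK Sfin.
have [U HU] : {U : T -> set T & forall u, K u ->
    [/\ open (U u), U u u & finite_set (S `&` U u)]}.
  apply: (@choice _ _ (fun u V => K u -> [/\ open V, V u & finite_set (S `&` V)])).
  move=> u; have [Ku|nKu] := pselect (K u); last by exists setT.
  by have [V HV] := Sfin _ Ku; exists V.
have [|u Ku|D DK KD] := cK T K U.
- by move=> u /HU[].
- by exists u => //; have [] := HU _ Ku.
apply: (@sub_finite_set _ _ (\bigcup_(u in [set` D]) (S `&` U u))).
  by move=> s Ss; have [u Du Uus] := KD _ (SK _ Ss); exists u.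
apply: bigcup_finite => // u /= Du.
by have /set_mem/HU[] := DK _ Du.
Qed.

Section paths.
Context {R : realType} {Omega : Type} (X : R -> Omega -> R) (w : Omega).
Hypothesis hX : cadlag X.

(** Both one-sided limits at s are limits of values of the path inside (a, b), so
    they stay in the closed band of radius e around l. *)
Lemma norm_jump_le (a b l e : R) : 0 <= a ->
  (forall r, a < r < b -> `|l - X r w| <= e) ->
  forall s, a < s < b -> `|jump X s w| <= e *+ 2.
Proof.
move=> a0 Xle s /andP[as_ sb].
have s0 : 0 < s by exact: le_lt_trans as_.
have [Xr Xl] := hX w.
have lim_le (F : set_system R) (FF : ProperFilter F) :
    (\forall r \near F, a < r < b) -> cvg (X r w @[r --> F]) ->
    `|l - lim (X r w @[r --> F])| <= e.
  move=> Fab cX; rewrite ler_distlC.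
  have := @closed_cvg _ _ F FF (fun r => X r w) [set` `[l - e, l + e]] _ _ _ cX.
  rewrite /= in_itv/=; apply; first exact: interval_closed.
  by apply: filterS Fab => r rab; rewrite /= in_itv/= -ler_distlC; exact: Xle.
have -> : jump X s w = (l - left_limit X s w) - (l - right_limit X s w).
  by rewrite /jump opprB [RHS]addrC addrA subrK.
rewrite mulr2n (le_trans (ler_normB _ _))// lerD//.
  rewrite /left_limit gt_eqF//; apply: lim_le; last exact: Xl.
  near=> r; apply/andP; split; first by near: r; exact: nbhs_left_gt.
  by apply: lt_trans sb; near: r; exact: nbhs_left_lt.
apply: lim_le.
  near=> r; apply/andP; split; last by near: r; exact: nbhs_right_lt.
  by apply: (lt_trans as_); near: r; exact: nbhs_right_gt.
by apply/cvg_ex; exists (X s w); apply: Xr; exact: ltW.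
Unshelve. all: by end_near. Qed.

(** The size e can be reached near u only at u itself: on each side of u the path
    is within e / 3 of its one-sided limit, hence jumps by at most 2 e / 3. *)
Lemma finite_large_jumps (t e : R) : 0 < e ->
  finite_set [set s | 0 < s <= t /\ e <= `|jump X s w|].
Proof.
move=> e0; set S := [set s | _ ].
have e3 : 0 < e / 3 by rewrite divr_gt0.
have e32 : e / 3 *+ 2 < e by lra.
have [Xr Xl] := hX w.
apply: (@finite_of_locally_finite R `[0, t]).
- exact: segment_compact.
- by move=> s [/andP[s0 st] _]; rewrite /= in_itv/= (ltW s0).
move=> u; rewrite /= in_itv/= => /andP[u0 ut].
have /cvgrPdist_le/(_ _ e3)/nbhs_ballP[/= c c0 Hc] := Xr _ u0.
have [c' c'0 Hc'] : exists2 c', 0 < c' & forall s, 0 < s -> u - c' < s < u ->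
    `|jump X s w| < e.
  (* There is nothing on the left of u when u = 0; otherwise the band is taken
     around the left limit, which exists only at positive times. *)
  move: u0; rewrite le_eqVlt => /predU1P[<-|u0].
    by exists 1 => // s s0 /andP[_ /(lt_trans s0)]; rewrite ltxx.
  have /cvgrPdist_le/(_ _ e3)/nbhs_ballP[/= c' c'0 Hc'] := Xl _ u0.
  exists c' => // s s0 /andP[us su].
  apply: le_lt_trans e32.
  (* The interval is cut at 0, the path being arbitrary at negative times. *)
  apply: (@norm_jump_le (Num.max 0 (u - c')) u (lim (X r w @[r --> u^'-]))).
  - by rewrite le_max lexx.
  - move=> r /andP[]; rewrite gt_max => /andP[r0 ur] ru; apply: Hc' => //.
    by rewrite /ball/= ltr_distlC; lra.
  - by rewrite gt_max s0 us su.
exists (ball u (Num.min c c')); split.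
- exact: ball_open.
- by apply: ballxx; rewrite lt_min c0.
apply: (@sub_finite_set _ _ [set u]) => // s [[/andP[s0 st] ejs]].
rewrite /ball/= lt_min => /andP[usc usc'] /=.
case: (ltgtP s u) => // su.
- have : `|jump X s w| < e; last by rewrite ltNge ejs.
  by apply: Hc' => //; rewrite su andbT; move: usc'; rewrite ltr_distl; lra.
- have : `|jump X s w| < e; last by rewrite ltNge ejs.
  apply: le_lt_trans e32.
  apply: (@norm_jump_le u (u + c) (X u w)) => //.
    move=> r /andP[ur rc]; apply: Hc => //.
    by rewrite /ball/= ltr_distlC; lra.
  by rewrite su; move: usc; rewrite ltr_distlC; lra.
Qed.

Definition jump_times (A : set R) (t : R) : set R :=
  [set s | 0 < s <= t /\ A (jump X s w)].

(** A set whose closure avoids 0 is bounded away from 0. *)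
Lemma finite_jump_times (A : set R) (t : R) : ~ closure A 0 ->
  finite_set (jump_times A t).
Proof.
move=> /existsNP[B /not_implyP[/nbhs_ballP[/= e e0 eB]]].
move=> /set0P/negP/negPn/eqP AB.
apply: sub_finite_set (finite_large_jumps t e0) => s [st As]; split => //.
rewrite leNgt; apply/negP => es.
suff : (A `&` B) (jump X s w) by rewrite AB.
by split => //; apply: eB; rewrite /ball/= sub0r normrN.
Qed.

End paths.

(** * Integration against a finite sum of Dirac masses *)

Lemma fsum_funeposBneg (R : realType) (I : choiceType) (S : set I) (g : I -> R) :
  finite_set S ->
  (\sum_(s \in S) (EFin \o g)^\+ s - \sum_(s \in S) (EFin \o g)^\- s =
   (\sum_(s \in S) g s)%:E)%E.
Proof.
move=> finS; rewrite funerpos funerneg /comp !fsumEFin// -EFinB; congr EFin.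
rewrite -[in RHS](funrposBneg g) !fsbig_finite//= -sumrB.
by apply: eq_bigr.
Qed.

Section integral_finite_diracs.
Context d (T : measurableType d) (R : realType) (mu : {measure set T -> \bar R}).
Variables (D : set T) (I : choiceType) (S : set I) (x : I -> T).
Hypotheses (mD : measurable D) (finS : finite_set S).
Hypothesis SD : forall i, S i -> D (x i).
Hypothesis muE : forall B, measurable B -> B `<=` D ->
  mu B = (\sum_(i \in S) (\d_(x i) B : \bar R))%E.
Local Open Scope ereal_scope.

(** Additivity of the integral in the measure applies to sums indexed by an
    initial segment of the integers, hence the listing of S as a sequence. *)
Lemma ge0_integral_finite_diracs (g : T -> \bar R) :
  measurable_fun D g -> (forall p, D p -> 0 <= g p) ->
  \int[mu]_(p in D) g p = \sum_(i \in S) g (x i).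
Proof.
move=> mg g0.
have [s us Ss] : exists2 s : seq I, uniq s & S = [set` s].
  exists (enum_fset (fset_set S)); first exact: fset_uniq.
  by rewrite fset_setK.
rewrite (eq_measure_integral (msum
      (fun k => \d_(nth point (map x s) k) : {measure set T -> \bar R})
      (size (map x s)))); last first.
  move=> B mB BD; rewrite muE// Ss -fsbig_seq// /msum.
  rewrite -(big_map x xpredT (fun p => \d_p B : \bar R)).
  by rewrite (big_nth point) big_mkord.
rewrite ge0_integral_measure_sum//.
transitivity (\sum_(k < size (map x s)) g (nth point (map x s) k)).
  apply: eq_bigr => k _; rewrite integral_dirac// diracE mem_set ?mul1e//.
  have /mapP[i si ->] := mem_nth point (ltn_ord k).
  by apply: SD; rewrite Ss.
by rewrite Ss -fsbig_seq// -(big_map x xpredT g) (big_nth point) big_mkord.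
Qed.

Lemma integral_finite_diracs (g : T -> R) : measurable_fun D g ->
  \int[mu]_(p in D) (g p)%:E = (\sum_(i \in S) g (x i))%:E.
Proof.
move=> /measurable_EFinP mg.
rewrite -fsum_funeposBneg// integralE; congr (_ - _).
- rewrite (@ge0_integral_finite_diracs (EFin \o g)^\+)//.
    by apply: eq_fsbigr => i _; rewrite !funeposE.
  exact: measurable_funepos.
- rewrite (@ge0_integral_finite_diracs (EFin \o g)^\-)//.
    by apply: eq_fsbigr => i _; rewrite !funenegE.
  exact: measurable_funeneg.
Qed.

End integral_finite_diracs.

(** * The jump measure away from zero jumps *)

Section jump_measure_finite.
Context {R : realType} {Omega : Type} (X : R -> Omega -> R) (w : Omega).
Variables (A : set R) (t : R).
Hypotheses (hX : cadlag X) (mA : measurable A) (hA0 : ~ closure A 0).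

Local Notation jump_times := (jump_times X w A t).

Let A0 : ~ A 0. Proof. by move=> /subset_closure. Qed.

(** The sum defining the jump measure runs over all positive times, but only the
    finitely many times of [jump_times] can contribute to a subset of
    [0, t] x A, and there the jump is nonzero because 0 is not in A. *)
Lemma jump_measureE (B : set (R * R)) : B `<=` `[0, t] `*` A ->
  jump_measure X w B = (\sum_(s \in jump_times) (\d_(s, jump X s w) B : \bar R))%E.
Proof.
move=> BD; rewrite -esum_fset//; last exact: finite_jump_times.
rewrite /jump_measure esum_mkcond [RHS]esum_mkcond; apply: eq_esum => s _.
rewrite diracE indicE.
have [Bs|Bs] := boolP ((s, jump X s w) \in B); last by rewrite mul0r !if_same.
have [/= + As] := BD _ (set_mem Bs); rewrite in_itv/= => /andP[s0 st].
have j0 : (~` [set 0]) (jump X s w) by move=> /= j0; apply: A0; rewrite -j0.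
rewrite mul1r indicE (mem_set j0).
congr (if _ then _ else _); apply/idP/idP; rewrite !inE /jump_times/=.
  by move=> ->.
by move=> [/andP[]].
Qed.

Let mD : measurable (`[0, t] `*` A : set (R * R)).
Proof. by apply: measurableX. Qed.

Let jump_timesD s : jump_times s -> (`[0, t] `*` A) (s, jump X s w).
Proof. by move=> [/andP[s0 st] As]; split => //=; rewrite in_itv/= (ltW s0). Qed.

Lemma integral_jump_measure (g : R * R -> R) :
  measurable_fun (`[0, t] `*` A) g ->
  (\int[jump_measure X w]_(p in `[0%R, t] `*` A) (g p)%:E =
   (\sum_(s \in jump_times) g (s, jump X s w))%:E)%E.
Proof.
move=> mg; apply: (integral_finite_diracs (x := fun s => (s, jump X s w))) => //.
- exact: finite_jump_times.
- by move=> B _; exact: jump_measureE.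
Qed.

Lemma jump_measureT : jump_measure X w (`[0, t] `*` A) =
  (\sum_(s \in jump_times) (1 : R))%:E.
Proof.
rewrite jump_measureE// -fsumEFin; last exact: finite_jump_times.
apply: eq_fsbigr => s /set_mem Ss.
by rewrite diracE mem_set//; exact: jump_timesD.
Qed.

Lemma esum_jump_times (g : R -> \bar R) :
  (forall s, 0 <= g s)%E -> (forall s, ~ A (jump X s w) -> g s = 0%E) ->
  \esum_(s in `]0, t]) g s = (\sum_(s \in jump_times) g s)%E.
Proof.
move=> g0 gA; rewrite -esum_fset//; last exact: finite_jump_times.
rewrite esum_mkcond [RHS]esum_mkcond; apply: eq_esum => s _.
have [As|As] := pselect (A (jump X s w)); last by rewrite gA// !if_same.
congr (if _ then _ else _); apply/idP/idP; rewrite !inE /jump_times/= in_itv//=.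
by move=> [].
Qed.

End jump_measure_finite.

(** * Summation along times exhausting the jumps *)

Section jump_series.
Context {R : realType} {d : measure_display} {Omega : measurableType d}.
Variables (X : R -> Omega -> R) (w : Omega).
Variables (A : set R) (t : R) (T : nat -> Omega -> \bar R).
Hypotheses (hX : cadlag X) (hA0 : ~ closure A 0).
Hypotheses (hT0 : forall n, (0 <= T n w)%E)
  (hTdisj : trivIset [set: nat] (fun n => graph (T n)))
  (hT : jump_set X = \bigcup_n graph (T n)).

(** The left limit at time 0 is by convention the right limit, so 0 is never a
    jump time: this reconciles the graphs, which live on nonnegative times, with
    [jump_times], which lives on positive ones. *)
Lemma jump0 : jump X 0 w = 0.
Proof. by rewrite /jump /left_limit eqxx subrr. Qed.

Lemma graph_jump_times s : jump_times X w A t s -> exists n, T n w = s%:E.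
Proof.
move=> [/andP[s0 _] As].
have : jump_set X (w, s).
  split => /=; first exact: ltW.
  by apply/eqP => j0; apply: hA0; apply: subset_closure; rewrite -j0.
by rewrite hT => -[n _ [_ /= Tn]]; exists n.
Qed.

Lemma graph_inj n m s : 0 <= s -> T n w = s%:E -> T m w = s%:E -> n = m.
Proof.
by move=> s0 Tn Tm; apply: hTdisj => //; exists (w, s); split; split.
Qed.

(** Disjointness of the graphs makes [n |-> T n w] a bijection from the set I of
    the indices with [T n w] in [jump_times] onto [jump_times].  Hence I is
    finite, the terms outside I vanish, and the partial sums are constant as soon
    as they include all of I. *)
Lemma jump_series_cvg (g : R -> R) : (forall s, ~ A (jump X s w) -> g s = 0) ->
  (\sum_(0 <= n < N) (eval_at_time g (T n w) *
     \1_[set w' | (T n w' <= t%:E)%E] w)%:E)%E @[N --> \oo] -->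
  (\sum_(s \in jump_times X w A t) g s)%:E.
Proof.
move=> gA; set S := jump_times X w A t.
have S0 s : S s -> 0 <= s by move=> [/andP[/ltW]].
pose I : set nat := (T ^~ w) @^-1` (EFin @` S).
have finI : finite_set I.
  apply: finite_preimage; last first.
    by apply: finite_image; exact: finite_jump_times.
  move=> n m /set_mem[s Ss Tn] _ Tnm; apply: (graph_inj (S0 _ Ss)) => //.
  by rewrite -Tnm.
have bijT : set_bij I S (fun n => fine (T n w)).
  split.
  - by move=> n [s Ss /= <-].
  - move=> n m /set_mem[s Ss /= Tn] /set_mem[r Sr /= Tm].
    by rewrite -Tn -Tm /= => sr; apply: (graph_inj (S0 _ Ss)) => //; rewrite sr.
  - move=> s Ss; have [n Tn] := graph_jump_times Ss.
    by exists n; rewrite ?/I/= Tn//; exists s.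
pose a n := eval_at_time g (T n w) * \1_[set w' | (T n w' <= t%:E)%E] w.
have aI n : I n -> a n = g (fine (T n w)).
  move=> [s [/andP[_ st] As] /= Tn].
  by rewrite /a -Tn indicE mem_set/= ?mulr1// -Tn lee_fin.
have aNI n : ~ I n -> a n = 0.
  move=> NI; rewrite /a indicE; case: (boolP (_ \in _)); last by rewrite mulr0.
  rewrite mulr1 inE/=; case Tn : (T n w) => [s| |]//=; rewrite lee_fin => st.
  have [s0 js] : jump_set X (w, s).
    rewrite hT; exists n => //; split => //=.
    by have := hT0 n; rewrite Tn lee_fin.
  apply: gA => As; apply: NI; exists s => //; split => //.
  rewrite st andbT lt_neqAle s0 andbT; apply: contra js => /eqP<-.
  by rewrite /= jump0.
have [M IM] : exists M, forall n, I n -> (n < M)%N.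
  exists (\max_(n <- fset_set I) n).+1 => n In.
  by rewrite ltnS; apply: leq_bigmax_seq => //; rewrite in_fset_set// inE.
apply: cvg_near_cst; exists M => // N /= MN.
rewrite sumEFin; congr EFin.
rewrite big_mkord (fsbig_ord _ N a) -(fsbig_widen I).
- rewrite (reindex_fsbig _ _ _ _ bijT); apply: eq_fsbigr => n /set_mem; exact: aI.
- by move=> n /IM nM; exact: leq_trans MN.
- by move=> n [_ /aNI].
Qed.

End jump_series.

Theorem proposition2 (R : realType) (d : measure_display)
    (Omega : measurableType d) (P : probability Omega R)
    (F : R -> set (set Omega))
    (hF : filtration F) (hFP : usual_conditions P F)
    (X : R -> Omega -> R) (hXF : adapted F X) (hX : cadlag X)
    (f : R * R -> R) (hf : measurable_fun [set p : R * R | 0 <= p.1] f)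
    (A : set R) (hA : measurable A) (hA0 : ~ closure A 0)
    (t : R) (ht : 0 < t)
    (T : nat -> Omega -> \bar R)
    (hTF : forall n, stopping_time F (T n))
    (hTdisj : trivIset [set: nat] (fun n => graph (T n)))
    (hT : jump_set X = \bigcup_n graph (T n)) :
  {ae P, forall w,
    let j := jump_measure X w in
    let summand s := f (s, jump X s w) * \1_A (jump X s w) in
    [/\ j.-integrable [set p : R * R | 0 <= p.1]
          (fun p => (\1_(`[0, t] `*` A) p * f p)%:E),
        summable `]0, t] (EFin \o summand),
        (\int[j]_(p in `[0%R, t] `*` A) (f p)%:E)%E = family_sum `]0, t] summand
      & (\sum_(0 <= n < N) (eval_at_time summand (T n w) *
            \1_[set w' | (T n w' <= t%:E)%E] w)%:E)%E @[N --> \oo] -->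
          (\int[j]_(p in `[0%R, t] `*` A) (f p)%:E)%E]} /\
  (forall w, exists c : R, 0 <= c /\
    (\int[jump_measure X w]_(p in `[0%R, t] `*` A) `|(f p)%:E| <=
       c%:E * jump_measure X w (`[0%R, t] `*` A))%E).
Proof.
set D := `[0%R, t] `*` A; set H := [set p : R * R | 0 <= p.1].
have mD : measurable D by apply: measurableX.
have mH : measurable H.
  rewrite (_ : H = `[0%R, +oo[ `*` setT); first exact: measurableX.
  by apply/seteqP; split => p /=; rewrite in_itv/= andbT => // -[].
have DH : D `<=` H by move=> p [/=]; rewrite in_itv/= => /andP[].
have mfD : measurable_fun D f by exact: measurable_funS hf.
have mnfD : measurable_fun D (fun p => `|f p|) by exact: measurableT_comp.
have finS w : finite_set (jump_times X w A t) by exact: finite_jump_times.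
split; last first.
  move=> w; pose c := \sum_(s \in jump_times X w A t) `|f (s, jump X s w)|.
  exists c; split; first exact: fsumr_ge0.
  rewrite jump_measureT// (integral_jump_measure w hX hA hA0 mnfD) -EFinM lee_fin.
  rewrite mulr_fsumr -lee_fin -!fsumEFin//.
  apply: lee_fsum => // s Ss; rewrite lee_fin mulr1 /c.
  rewrite (fsbigD1 s)//= lerDl; exact: fsumr_ge0.
apply: aeW => w; set j := jump_measure X w.
set summand := fun s : R => f (s, jump X s w) * \1_A (jump X s w).
have summandE s : jump_times X w A t s -> summand s = f (s, jump X s w).
  by move=> [_ As]; rewrite /summand indicE mem_set ?mulr1.
have summand0 s : ~ A (jump X s w) -> summand s = 0.
  by move=> As; rewrite /summand indicE memNset ?mulr0.
have intE : (\int[j]_(p in D) (f p)%:E)%E =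
    (\sum_(s \in jump_times X w A t) summand s)%:E.
  rewrite (integral_jump_measure w hX hA hA0 mfD); congr EFin.
  by apply: eq_fsbigr => s /set_mem/summandE.
split.
- apply/integrableP; split.
    by apply/measurable_EFinP; exact: measurable_funM.
  rewrite [ltLHS](_ : _ = (\int[j]_(p in D) `|(f p)%:E|)%E).
    by rewrite (integral_jump_measure w hX hA hA0 mnfD) ltry.
  rewrite -[in RHS](setIidr DH) integral_mkcondr; apply: eq_integral => p _.
  rewrite patchE indicE; case: ifPn => _; first by rewrite mul1r.
  by rewrite mul0r abse0.
- rewrite /summable (@esum_jump_times _ _ X w A t hX hA0)//; last first.
    by move=> s /summand0 /= ->; rewrite normr0.
  by rewrite fsumEFin ?ltry.
- rewrite intE /family_sum !(@esum_jump_times _ _ X w A t hX hA0)//.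
  + by rewrite fsum_funeposBneg.
  + by move=> s /summand0; rewrite funenegE /= => ->; rewrite oppr0 maxxx.
  + by move=> s /summand0; rewrite funeposE /= => ->; rewrite maxxx.
- rewrite intE; apply: (jump_series_cvg hX hA0) => //.
  by move=> n; have [] := hTF n.
Qed.
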